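(* Let $n \ge 1$ be an integer, let $\mathcal{A}$ be one of the sets $\mathbb{C}$, $\mathbb{R}$, or $\mathbb{R}^+ \cup \{0\}$, and let $\Phi : \mathcal{A} \to \mathcal{H}_n(\mathbb{C})$ be a J.T.P. homomorphism. Then there exist a unitary $n \times n$ complex matrix $T$, a diagonal $n\times n$ matrix $D$ with $\pm 1$'s on its diagonal, and multiplicative maps $\varphi_1, \varphi_2, \ldots, \varphi_n : \mathcal{A} \to \mathbb{R}$ such that $$\Phi(\lambda) = T D \begin{bmatrix} \varphi_1(\lambda) & 0 & \cdots & 0 \\ 0 & \varphi_2(\lambda) & \cdots & 0 \\ \vdots & \vdots & \ddots & \vdots \\ 0 & 0 & \cdots & \varphi_n(\lambda) \end{bmatrix} T^*, \qquad \lambda \in \mathcal{A}.$$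
   Context: $\mathcal{H}_n(\mathbb{C})$ denotes the set of all Hermitian $n\times n$ complex matrices, $\mathbb{R}^+$ the set of positive real numbers, and $T^*$ the conjugate transpose of $T$. A map $\Phi$ is a Jordan triple product homomorphism (J.T.P. homomorphism) if $\Phi(ABA) = \Phi(A)\Phi(B)\Phi(A)$ for all $A, B$ in its domain (no additivity or continuity is assumed); here the elements of the domain are scalars. A map $\varphi$ is multiplicative if $\varphi(\lambda\mu) = \varphi(\lambda)\varphi(\mu)$ for all $\lambda, \mu$ in its domain. *)

(* Defs.v *)
From HB Require Import structures.
From mathcomp Require Export all_boot all_order all_algebra.
From mathcomp Require Export reals.
From mathcomp Require Export complex.

Set Implicit Arguments.
Unset Strict Implicit.
Unset Printing Implicit Defensive.

Import Order.TTheory GRing.Theory Num.Theory.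
Local Open Scope ring_scope.
Local Open Scope complex_scope.
Local Open Scope sesquilinear_scope.

(* The scalar sets are subsets of R[i]. Its order satisfies z <= w iff
   Im z = Im w and Re z <= Re w, so Num.real is the real line and Num.nneg is
   the half-line of nonnegative reals. *)
Definition scalar_domain (R : realType) (A : {pred R[i]}) : Prop :=
  [\/ A =i predT, A =i Num.real | A =i Num.nneg].

(* Maps defined on A are represented by total functions about which nothing
   is assumed outside A. *)
Definition herm_valued_on (R : realType) (n : nat) (A : {pred R[i]})
    (Phi : R[i] -> 'M[R[i]]_n) : Prop :=
  {in A, forall a, Phi a \is hermsymmx}.

Definition jtp_hom_on (R : realType) (n : nat) (A : {pred R[i]})
    (Phi : R[i] -> 'M[R[i]]_n) : Prop :=
  {in A &, forall a b, Phi (a * b * a) = Phi a *m Phi b *m Phi a}.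

Definition multiplicative_on (R : realType) (A : {pred R[i]})
    (phi : R[i] -> R) : Prop :=
  {in A &, forall a b, phi (a * b) = phi a * phi b}.

(* Main.v *)
Require Import Defs.
From mathcomp Require Import boolp.

Set Implicit Arguments.
Unset Strict Implicit.
Unset Printing Implicit Defensive.

Import Order.TTheory GRing.Theory Num.Theory.
Local Open Scope ring_scope.
Local Open Scope complex_scope.
Local Open Scope sesquilinear_scope.

(** Write E for Phi 1. From 1 = 1 * 1 * 1 and a = 1 * a * 1 one gets E^3 = E
    and Phi a = E Phi(a) E, so E commutes with every Phi a and E^2 acts on them
    as an identity. Hence Psi a = E Phi(a) is again a Hermitian-valued Jordan
    triple homomorphism, which moreover satisfies Psi(a^2) = Psi(a)^2.

    The values of Psi commute. Computing Psi((ab)^2) in two ways gives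
    X Y^2 X = Y X^2 Y for X = Psi a and Y = Psi b; for Hermitian matrices this
    forces X^2 Y = Y X^2, since the squared Frobenius norm of the commutator is
    a sum of traces that cancel ([hermsymmx_sqr_comm]). So Psi(a^2) commutes
    with Psi b. Each scalar is either a square in the domain or the opposite of
    a fourth power, the latter only when -1 is in the domain
    ([scalar_domain_root]), which settles all pairs ([jtp_hom_comm]). Once the
    values commute, Psi(s b s) = Psi(s)^2 Psi(b) says that Psi is
    multiplicative ([jtp_hom_mul]).

    Consequently the matrices Phi a commute too and have a common unitary
    eigenbasis T ([commuting_hermsymmx_diag]). In that basis E has diagonal
    entries e_i with e_i^3 = e_i, and Psi is diagonal with multiplicative
    entries phi_i. Since Phi a = E Psi(a), D may be taken to be E with its zero
    entries replaced by 1: where e_i = 0 the entry of Psi vanishes anyway. *)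

(** * Hermitian matrices over a numeric closed field *)

Lemma mxtrace_mul_trmxC_eq0 (C : numClosedFieldType) m n (M : 'M[C]_(m, n)) :
  \tr (M *m M^t*) = 0 -> M = 0.
Proof.
have trE : \tr (M *m M^t*) = \sum_i \sum_j `|M i j| ^+ 2.
  apply: eq_bigr => i _; rewrite mxE; apply: eq_bigr => j _.
  by rewrite !mxE -normCK.
rewrite trE => tr0; apply/matrixP => i j; rewrite mxE.
have row0 : \sum_k `|M i k| ^+ 2 = 0.
  apply: (psumr_eq0P _ tr0) => // k _.
  by apply: sumr_ge0 => l _; rewrite exprn_ge0.
have sq0 : `|M i j| ^+ 2 = 0.
  by apply: (psumr_eq0P _ row0) => // k _; rewrite exprn_ge0.
by apply/eqP; rewrite -normr_eq0 -sqrf_eq0 sq0.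
Qed.

Lemma hermsymmx_trmxC (C : numClosedFieldType) n (M : 'M[C]_n) :
  M \is hermsymmx -> M^t* = M.
Proof. by move=> /is_hermitianmxP {2}->; rewrite expr0 scale1r. Qed.

Lemma hermsymmx_mul (C : numClosedFieldType) n (X Y : 'M[C]_n) :
  X \is hermsymmx -> Y \is hermsymmx -> comm_mx X Y -> X *m Y \is hermsymmx.
Proof.
move=> hX hY cXY; apply/is_hermitianmxP; rewrite expr0 scale1r.
by rewrite trmx_mul map_mxM !hermsymmx_trmxC.
Qed.

(** The hypothesis says that X *m Y is normal. With U = X *m X, the commutator
    U Y - Y U has squared Frobenius norm
    tr (U Y Y U) - tr (U Y U Y) - tr (Y U Y U) + tr (Y U U Y), and the
    hypothesis together with cyclicity makes every term tr (U U Y Y) up to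
    sign. *)
Lemma hermsymmx_sqr_comm (C : numClosedFieldType) n (X Y : 'M[C]_n) :
    X \is hermsymmx -> Y \is hermsymmx ->
    X *m (Y *m Y) *m X = Y *m (X *m X) *m Y ->
  comm_mx (X *m X) Y.
Proof.
move=> hX hY XYYX; apply/subr0_eq/mxtrace_mul_trmxC_eq0.
rewrite linearB map_mxB /= !trmx_mul !map_mxM !hermsymmx_trmxC //.
rewrite mulmxBl !mulmxBr !raddfB /=.
pose U := X *m X; rewrite -/U.
have trUYYU : \tr (U *m Y *m (Y *m U)) = \tr (U *m U *m (Y *m Y)).
  by rewrite mxtrace_mulC -!mulmxA mxtrace_mulC !mulmxA.
have trYUUY : \tr (Y *m U *m (U *m Y)) = \tr (U *m U *m (Y *m Y)).
  by rewrite mxtrace_mulC mxtrace_mulC -!mulmxA mxtrace_mulC !mulmxA.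
have trUYUY : \tr (U *m Y *m (U *m Y)) = \tr (U *m U *m (Y *m Y)).
  (* here the hypothesis turns Y *m U *m Y into X *m (Y *m Y) *m X *)
  have -> : U *m Y *m (U *m Y) = U *m (X *m (Y *m Y)) *m X.
    by rewrite -(mulmxA U (X *m _)) XYYX !mulmxA.
  by rewrite mxtrace_mulC !mulmxA.
have trYUYU : \tr (Y *m U *m (Y *m U)) = \tr (U *m U *m (Y *m Y)).
  by rewrite -trUYUY -!mulmxA mxtrace_mulC !mulmxA.
by rewrite trUYYU trYUUY trUYUY trYUYU !subrr addr0.
Qed.

(** Lets statements about finite lists of matrices, such as
    [cotrigonalization], apply to arbitrary families: a list of members of the
    family is enlarged as long as this increases the dimension of its span. *)
Lemma span_of_predicate (K : fieldType) (V : vectType K) (P : V -> Prop) :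
  exists2 s : seq V, {in s, forall v, P v} & forall v, P v -> v \in <<s>>%VS.
Proof.
suff ext k (s : seq V) : {in s, forall v, P v} ->
    (\dim {:V} <= \dim <<s>> + k)%N ->
    exists2 s : seq V, {in s, forall v, P v} & forall v, P v -> v \in <<s>>%VS.
  by apply: (ext (\dim {:V}) [::]) => //; rewrite leq_addl.
elim: k s => [|k IHk] s sP dims.
  exists s => // v _.
  have /eqP -> : <<s>>%VS == fullv.
    by rewrite eqEdim subvf -[X in (_ <= X)%N]addn0.
  exact: memvf.
have [[v Pv vNs]|sfull] := pselect (exists2 v, P v & v \notin <<s>>%VS).
  apply: (IHk (v :: s)) => [w|].
    by rewrite inE => /orP[/eqP ->|/sP].
  rewrite (leq_trans dims) // addnS -addSn leq_add2r span_cons.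
  rewrite ltnNge; apply: contra vNs => dimvs.
  have /eqP -> : <<s>>%VS == (<[v]> + <<s>>)%VS by rewrite eqEdim addvSr.
  exact: subvP (addvSl _ _) _ (memv_line _).
exists s => // v Pv; apply/negPn/negP => vNs.
by apply: sfull; exists v.
Qed.

(** A finite list spanning the family can be made triangular in one unitary
    basis; triangularity passes to linear combinations, and a Hermitian
    triangular matrix is diagonal with real entries. *)
Lemma commuting_hermsymmx_diag (C : numClosedFieldType) n
    (S : 'M[C]_n -> Prop) :
    (forall M, S M -> M \is hermsymmx) ->
    (forall M N, S M -> S N -> comm_mx M N) ->
  exists2 T : 'M[C]_n, T \is unitarymx &
    forall M, S M -> exists2 d : 'rV[C]_n,
      (forall i, d 0 i \is Num.real) & M = T *m diag_mx d *m T^t*.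
Proof.
move=> herm comm; have [s sS Sspan] := span_of_predicate S.
have [|P uP /allP trigP] := @cotrigonalization _ _ s.
  by move=> M N /sS SM /sS SN; apply: comm.
exists (P^t*); first by rewrite trmxC_unitary.
move=> M SM; rewrite trmxCK; have hM := herm M SM.
have trigM : is_trig_mx (P *m M *m P^t*).
  rewrite (@coord_span _ _ _ (in_tuple s) _ (Sspan M SM)).
  rewrite mulmx_sumr mulmx_suml.
  apply/is_trig_mxP => i j ij; rewrite summxE big1 // => k _.
  rewrite -scalemxAr -scalemxAl mxE.
  have := trigP _ (mem_nth 0 (ltn_ord k)).
  rewrite /= /similar_to /= conjymx // => /is_trig_mxP/(_ i j ij) ->.
  by rewrite mulr0.
have hN : P *m M *m P^t* \is hermsymmx.
  apply/is_hermitianmxP; rewrite expr0 scale1r.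
  by rewrite !trmx_mul !map_mxM trmxCK (hermsymmx_trmxC hM) mulmxA.
have Nconj i j : (P *m M *m P^t*) i j = ((P *m M *m P^t*) j i)^*%R.
  by rewrite -{1}(hermsymmx_trmxC hN) !mxE.
have /diag_mxP[d dE] : is_diag_mx (P *m M *m P^t*).
  rewrite is_diag_mxEtrig trigM; apply/is_trig_mxP => i j ij.
  by rewrite mxE Nconj (is_trig_mxP trigM _ _ ij) conjC0.
exists d => [i|].
  by apply/CrealP; have := Nconj i i; rewrite dE !mxE eqxx => /esym.
rewrite -dE !mulmxA -{1}invmx_unitary // mulVmx ?unitarymx_unit // mul1mx.
by rewrite -mulmxA -invmx_unitary // mulVmx ?unitarymx_unit // mulmx1.
Qed.

(** * The scalar domains *)

Lemma scalar_domain1 (R : realType) (A : {pred R[i]}) :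
  scalar_domain A -> 1 \in A.
Proof. by case=> ->; rewrite ?rpred1. Qed.

Lemma scalar_domainM (R : realType) (A : {pred R[i]}) :
  scalar_domain A -> {in A &, forall a b, a * b \in A}.
Proof. by case=> eqA a b; rewrite !eqA //; apply: rpredM. Qed.

(** In the second case the fourth power, rather than a square, is needed in
    [jtp_hom_comm]: it makes a = t * -1 * t with t = s * s itself a square, and
    the values at squares are the ones known to commute with all the others. *)
Lemma scalar_domain_root (R : realType) (A : {pred R[i]}) (a : R[i]) :
    scalar_domain A -> a \in A ->
  (exists2 s, s \in A & a = s * s) \/
  (-1 \in A /\ exists2 s, s \in A & a = - (s * s * (s * s))).
Proof.
have sqrtM (x : R[i]) : x = sqrtC x * sqrtC x by rewrite -expr2 sqrtCK.
have nneg_root x : 0 <= x -> sqrtC x \is @Num.nneg R[i].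
  by rewrite nnegrE sqrtC_ge0.
case=> eqA; rewrite eqA.
- by left; exists (sqrtC a); rewrite ?eqA.
- rewrite realE => /orP[a0|a0].
    by left; exists (sqrtC a) => //; rewrite eqA ger0_real // -nnegrE nneg_root.
  right; rewrite eqA rpredN rpred1; split=> //.
  have na0 : 0 <= - a by rewrite oppr_ge0.
  exists (sqrtC (sqrtC (- a))).
    by rewrite eqA ger0_real // -nnegrE nneg_root // -nnegrE nneg_root.
  by rewrite -!sqrtM opprK.
- by move=> a0; left; exists (sqrtC a); rewrite ?eqA ?nneg_root.
Qed.

(** * Scalar Jordan triple product homomorphisms *)

(** Both sides of X Y^2 X = Y X^2 Y, for X = Psi a and Y = Psi b, are the value
    at (a * b) ^+ 2, so [hermsymmx_sqr_comm] applies when one argument is a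
    square. The opposite of a fourth power goes to Psi(t) Psi(-1) Psi(t) with t
    a square; for two such arguments, every two factors commute, since Psi(-1)
    is the only one not taken at a square. *)
Lemma jtp_hom_comm (R : realType) n (A : {pred R[i]})
    (Psi : R[i] -> 'M[R[i]]_n) :
    scalar_domain A -> herm_valued_on A Psi -> jtp_hom_on A Psi ->
    {in A, forall a, Psi (a * a) = Psi a *m Psi a} ->
  {in A &, forall a b, comm_mx (Psi a) (Psi b)}.
Proof.
move=> dA herm jtp sq; have AM := scalar_domainM dA.
have sq_comm : {in A &, forall a b, comm_mx (Psi (a * a)) (Psi b)}.
  move=> a b Aa Ab; rewrite sq //; apply: hermsymmx_sqr_comm; rewrite ?herm //.
  rewrite -!sq // -!jtp ?AM //; congr Psi.
  by rewrite mulrAC [RHS]mulrAC mulrC.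
have neg_sq s : s \in A -> -1 \in A ->
    Psi (- (s * s)) = Psi s *m Psi (-1) *m Psi s.
  by move=> As AN1; rewrite -jtp // mulrN1 mulNr.
move=> a b Aa Ab.
have [[s As ->]|[AN1 [s As aE]]] := scalar_domain_root dA Aa.
  exact: sq_comm.
have [[t At ->]|[_ [t At bE]]] := scalar_domain_root dA Ab.
  by apply: comm_mx_sym; apply: sq_comm.
have comm_sq r x : r \in A -> x \in A -> comm_mx (Psi x) (Psi (r * r)).
  by move=> Ar Ax; apply: comm_mx_sym; apply: sq_comm.
rewrite aE bE !neg_sq ?AM //.
have commN1 : comm_mx (Psi (-1)) (Psi (t * t) *m Psi (-1) *m Psi (t * t)).
  by do !apply: comm_mxM; first [exact: comm_sq | exact: comm_mx_refl].
have comms : comm_mx (Psi (s * s)) (Psi (t * t) *m Psi (-1) *m Psi (t * t)).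
  by do !apply: comm_mxM; apply: sq_comm; rewrite ?AM.
by apply: comm_mx_sym; do !apply: comm_mxM; apply: comm_mx_sym.
Qed.

(** If a = s * s then a * b = s * b * s, whose image is Psi(s)^2 Psi(b) by
    commutation. When a and b are both opposites of squares, the two factors
    Psi(-1) combine into Psi 1. *)
Lemma jtp_hom_mul (R : realType) n (A : {pred R[i]})
    (Psi : R[i] -> 'M[R[i]]_n) :
    scalar_domain A -> jtp_hom_on A Psi ->
    {in A, forall a, Psi (a * a) = Psi a *m Psi a} ->
    {in A &, forall a b, comm_mx (Psi a) (Psi b)} ->
  {in A &, forall a b, Psi (a * b) = Psi a *m Psi b}.
Proof.
move=> dA jtp sq comm.
have A1 := scalar_domain1 dA; have AM := scalar_domainM dA.
have sq_mul s b : s \in A -> b \in A ->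
    Psi (s * s * b) = Psi (s * s) *m Psi b.
  move=> As Ab; rewrite mulrAC jtp // sq // -!mulmxA; congr (_ *m _).
  exact: comm.
move=> a b Aa Ab.
have [[s As ->]|[AN1 [s As aE]]] := scalar_domain_root dA Aa.
  exact: sq_mul.
have [[t At ->]|[_ [t At bE]]] := scalar_domain_root dA Ab.
  by rewrite mulrC sq_mul // comm ?AM.
have neg_sq r : r \in A -> Psi (- (r * r)) = Psi (r * r) *m Psi (-1).
  by move=> Ar; rewrite -sq_mul // mulrN1.
rewrite aE bE mulrNN sq_mul ?AM // !neg_sq ?AM //.
(* Psi (-1) squares to Psi 1, which acts on squares as an identity *)
rewrite -mulmxA; congr (_ *m _); rewrite (comm _ (-1)) ?AM // mulmxA.
by rewrite -(sq (-1)) // mulrNN -sq_mul ?AM // !mul1r.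
Qed.

(** Everything follows from Phi(1)^3 = Phi 1 and Phi a = Phi(1) Phi(a) Phi(1),
    the defining identity with outer factors 1. *)
Lemma jtp_hom_unit (R : realType) n (A : {pred R[i]})
    (Phi : R[i] -> 'M[R[i]]_n) :
    1 \in A -> jtp_hom_on A Phi ->
  {in A, forall a, comm_mx (Phi 1) (Phi a) /\
                   Phi 1 *m Phi 1 *m Phi a = Phi a}.
Proof.
move=> A1 jtp a Aa.
have E3 : Phi 1 *m Phi 1 *m Phi 1 = Phi 1 by rewrite -jtp // !mulr1.
have PE : Phi a = Phi 1 *m Phi a *m Phi 1 by rewrite -jtp // mul1r mulr1.
have EEP : Phi 1 *m Phi 1 *m Phi a = Phi a by rewrite PE !mulmxA E3.
by split=> //; rewrite /comm_mx {1}PE !mulmxA EEP.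
Qed.

(** * The diagonal form *)

Theorem theorem4p2 (R : realType) (n : nat) (hn : (1 <= n)%N)
    (A : {pred R[i]}) (hA : scalar_domain A)
    (Phi : R[i] -> 'M[R[i]]_n)
    (hherm : herm_valued_on A Phi) (hjtp : jtp_hom_on A Phi) :
  exists (T D : 'M[R[i]]_n) (phi : 'I_n -> R[i] -> R),
    [/\ T \is unitarymx,
        is_diag_mx D /\ (forall i, D i i = 1 \/ D i i = -1),
        forall i, multiplicative_on A (phi i) &
        {in A, forall a,
          Phi a = T *m D *m diag_mx (\row_i (phi i a)%:C) *m T ^t*}].
Proof.
have A1 := scalar_domain1 hA; have AM := scalar_domainM hA.
have Phi1P := jtp_hom_unit A1 hjtp.
pose Psi a := Phi 1 *m Phi a.
have PsiM a b : a \in A -> b \in A -> Psi a *m Psi b = Phi a *m Phi b.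
  move=> Aa Ab; rewrite /Psi mulmxA -(mulmxA (Phi 1) (Phi a)).
  by rewrite -(Phi1P _ Aa).1 mulmxA (Phi1P _ Aa).2.
have Psi_herm : herm_valued_on A Psi.
  by move=> a Aa; apply: hermsymmx_mul; rewrite ?hherm //; case: (Phi1P _ Aa).
have Psi_sq : {in A, forall a, Psi (a * a) = Psi a *m Psi a}.
  by move=> a Aa; rewrite /Psi -{1}[a]mulr1 hjtp // !mulmxA.
have Psi_jtp : jtp_hom_on A Psi.
  move=> a b Aa Ab; rewrite PsiM // /Psi hjtp // !mulmxA (Phi1P _ Aa).1.
  by rewrite -!mulmxA (mulmxA (Phi 1)) (Phi1P _ Ab).1 !mulmxA.
have Psi_comm := jtp_hom_comm hA Psi_herm Psi_jtp Psi_sq.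
have Psi_mul := jtp_hom_mul hA Psi_jtp Psi_sq Psi_comm.
have Phi_comm : {in A &, forall a b, comm_mx (Phi a) (Phi b)}.
  by move=> a b Aa Ab; have := Psi_comm a b Aa Ab; rewrite /comm_mx !PsiM.
have [|M N|T uT diagT] := @commuting_hermsymmx_diag R[i] n
  (fun M => exists2 a, a \in A & M = Phi a).
- by move=> M [a Aa ->]; apply: hherm.
- by case=> a Aa -> [b Ab ->]; apply: Phi_comm.
have eig a : exists d : 'rV[R]_n,
    a \in A -> Phi a = T *m diag_mx (\row_i (d 0 i)%:C) *m T^t*.
  have [Aa|] := boolP (a \in A); last by exists 0.
  have [d dreal ->] := diagT _ (ex_intro2 _ _ a Aa erefl).
  exists (\row_i complex.Re (d 0 i)) => _; congr (_ *m diag_mx _ *m _).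
  by apply/rowP=> i; rewrite !mxE RRe_real.
have {eig}[f fE] := choice eig.
have mulT (d e : 'rV[R[i]]_n) :
    T *m diag_mx d *m T^t* *m (T *m diag_mx e *m T^t*)
    = T *m diag_mx (\row_i (d 0 i * e 0 i)) *m T^t*.
  by rewrite !mulmxA mulmxKtV // -(mulmxA T) mulmx_diag.
have injT (d e : 'rV[R[i]]_n) :
    T *m diag_mx d *m T^t* = T *m diag_mx e *m T^t* -> d = e.
  have uTC : T^t* *m T = 1%:M.
    by rewrite -{2}[T]trmxCK; apply/unitarymxP; rewrite trmxC_unitary.
  move=> /(congr1 (fun M => T^t* *m M *m T)).
  rewrite !mulmxA uTC !mul1mx -!mulmxA uTC !mulmx1 => de.
  by apply/rowP => i; move/matrixP/(_ i i): de; rewrite !mxE eqxx.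
pose e i := f 1 0 i.
have PsiE a : a \in A ->
    Psi a = T *m diag_mx (\row_i (e i * f a 0 i)%:C) *m T^t*.
  move=> Aa; rewrite /Psi (fE 1) // (fE a) // mulT.
  by congr (_ *m diag_mx _ *m _); apply/rowP => i; rewrite !mxE rmorphM.
(* Phi(1)^2 Phi(a) = Phi(a), read off entrywise *)
have eef a i : a \in A -> e i * (e i * f a 0 i) = f a 0 i.
  move=> Aa; have := (Phi1P _ Aa).2; rewrite -mulmxA -/(Psi a) PsiE //.
  rewrite (fE 1) // (fE a) // mulT => /injT/rowP/(_ i).
  by rewrite !mxE -rmorphM => /complexI.
exists T, (diag_mx (\row_i (if e i == 0 then 1 else (e i)%:C))),
  (fun i a => e i * f a 0 i); split=> //.
- split=> [|i]; first exact: diag_mx_is_diag.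
  rewrite !mxE eqxx mulr1n; have [_|ei0] := eqVneq (e i) 0; first by left.
  have /eqP : e i ^+ 2 = 1.
    by apply: (mulIf ei0); rewrite mul1r expr2 -mulrA; apply: eef.
  by rewrite sqrf_eq1 => /orP[]/eqP ->; [left | right; rewrite rmorphN1].
- move=> i a b Aa Ab; have := Psi_mul a b Aa Ab.
  rewrite !PsiE ?AM // mulT => /injT/rowP/(_ i).
  by rewrite !mxE -rmorphM => /complexI.
(* where e i = 0, eef makes the entry of Phi a zero as well *)
move=> a Aa; rewrite (fE a) // -[in RHS](mulmxA T) mulmx_diag.
congr (_ *m diag_mx _ *m _); apply/rowP => i; rewrite !mxE -[in LHS]eef //.
by have [->|_] := eqVneq (e i) 0; rewrite ?mul0r ?mulr0 // rmorphM.
Qed.
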